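(* Let $0<\underline{\lambda}\le\bar{\lambda}<\infty$, let $\mathbf{A}=\mathbf{A}^\top\in\mathbb{R}^{n\times n}$ satisfy $\mathbf{A}\succeq0$ and $\operatorname{rank}(\mathbf{A})=r<n$, and assume that the non-zero eigenvalues of $\mathbf{A}$ lie in $[\underline{\lambda},\bar{\lambda}]$. For $k\in\mathbb{N}$ let $f_k(\mathbf{x})=\frac12\mathbf{x}^\top\mathbf{A}\mathbf{x}+\mathbf{x}^\top\mathbf{b}_k$, where $\mathbf{b}_k\in\operatorname{range}(\mathbf{A})$ for all $k$, and let $\mathbf{X}_k^*$ be the (affine) set of minimizers of $f_k$ over $\mathbb{R}^n$. Assume that $\{\mathbf{b}_k\}_{k\in\mathbb{N}}$ has a rational $\mathcal{Z}$-transform $\mathcal{Z}[\mathbf{b}_k]=\mathbf{B}_{\mathrm N}(z)/B_{\mathrm D}(z)$, where $\mathbf{B}_{\mathrm N}(z)$ is a vector of $n$ real polynomials and $B_{\mathrm D}(z)=z^m+\sum_{i=0}^{m-1}b_iz^i$ is a real polynomial whose roots are all marginally or asymptotically stable. Let the controller be $C(z)=C_{\mathrm N}(z)/C_{\mathrm D}(z)$ with $C_{\mathrm N}(z)=\sum_{i=0}^{m-1}c_iz^i$ a real polynomial, and assume that: (c1) (internal model) $C_{\mathrm D}(z)=B_{\mathrm D}(z)$; (c2) (stability) the polynomial $B_{\mathrm D}(z)-\lambda C_{\mathrm N}(z)$ is asymptotically stable for all $\lambda\in[\underline{\lambda},\bar{\lambda}]$. Then the output $\{\mathbf{x}_k\}_{k\in\mathbb{N}}$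 of the control-based online algorithm associated with $C(z)$ (defined in the context) satisfies $$\limsup_{k\to\infty}\ \operatorname{dist}(\mathbf{x}_k,\mathbf{X}_k^* )=0.$$
   Context: The $\mathcal{Z}$-transform of a sequence is $\mathcal{Z}[\mathbf{b}_k]=\sum_{k\ge0}\mathbf{b}_kz^{-k}$. A polynomial is asymptotically stable if all its roots satisfy $|z|<1$; ''marginally or asymptotically stable'' roots are roots with $|z|\le1$ (multiple roots on the unit circle, as for ramp signals, are used in the paper). $\|\cdot\|$ is the Euclidean norm and $\operatorname{dist}(\mathbf{x},\mathbf{X})=\min_{\mathbf{y}\in\mathbf{X}}\|\mathbf{x}-\mathbf{y}\|$. Control-based online algorithm associated with $C(z)=C_{\mathrm N}(z)/B_{\mathrm D}(z)$: let $\mathbf{F}\in\mathbb{R}^{m\times m}$ be the companion matrix with ones on the first superdiagonal, last row $(-b_0,\dots,-b_{m-1})$, and zeros elsewhere; let $\mathbf{G}=(0,\dots,0,1)^\top\in\mathbb{R}^m$ and $\mathbf{K}=(c_0,c_1,\dots,c_{m-1})\in\mathbb{R}^{1\times m}$. With state $\mathbf{w}_k\in\mathbb{R}^{nm}$ (arbitrary initial $\mathbf{w}_0$, $\mathbf{x}_0=(\mathbf{K}\otimes\mathbf{I})\mathbf{w}_0$), the algorithm is $$\mathbf{w}_{k+1}=(\mathbf{F}\otimes\mathbf{I})\mathbf{w}_k+(\mathbf{G}\otimes\mathbf{I})\nabla f_k(\mathbf{x}_k),\qquad \mathbf{x}_{k+1}=(\mathbf{K}\otimes\mathbf{I})\mathbf{w}_{k+1},$$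 where $\mathbf{I}$ is the $n\times n$ identity and $\otimes$ the Kronecker product. *)

(* Defs.v *)
From HB Require Import structures.
From mathcomp Require Import all_boot all_order all_algebra.
From mathcomp Require Import all_classical all_reals all_analysis.
From mathcomp Require Export complex mxtens.
Export numFieldNormedType.Exports.

Set Implicit Arguments.
Unset Strict Implicit.
Unset Printing Implicit Defensive.

Import Order.TTheory GRing.Theory Num.Theory.
Local Open Scope classical_set_scope.
Local Open Scope ring_scope.

Section Polynomials.
Variable R : realType.

(* Roots are the complex ones: p is mapped into R[i]. The order on R[i] makes
   [`|z| <= 1] the comparison of the (real) modulus of z with 1. *)
Definition marginally_or_asymptotically_stable (p : {poly R}) : Prop :=
  forall z : R[i], root (map_poly (real_complex R) p) z -> `|z| <= 1.

Definition asymptotically_stable (p : {poly R}) : Prop :=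
  forall z : R[i], root (map_poly (real_complex R) p) z -> `|z| < 1.

(* The Z-transform of u is N(z) / D(z): outside some disc of the complex plane,
   sum_(k >= 0) u_k z^-k converges, componentwise, to N(z) / D(z).
   The alias (R[i])^o carries the usual topology of the complex plane. *)
Definition has_rational_ztransform (n : nat) (u : nat -> 'cV[R]_n)
    (N : 'cV[{poly R}]_n) (D : {poly R}) : Prop :=
  exists rho : R, forall z : R[i], real_complex R rho < `|z| ->
    forall i : 'I_n,
      series (fun k => real_complex R (u k i 0) * z ^- k : (R[i])^o) @ \oo -->
        ((map_poly (real_complex R) (N i 0)).[z] /
         (map_poly (real_complex R) D).[z] : (R[i])^o).

End Polynomials.

Section Euclidean.
Variables (R : realType) (n : nat).

Definition pos_semidef (A : 'M[R]_n) : Prop :=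
  forall x : 'cV[R]_n, 0 <= (x^T *m A *m x) 0 0.

Definition quad_cost (A : 'M[R]_n) (b x : 'cV[R]_n) : R :=
  2^-1 * (x^T *m A *m x) 0 0 + (x^T *m b) 0 0.

Definition minimizers (f : 'cV[R]_n -> R) : set 'cV[R]_n :=
  [set y | forall x, f y <= f x].

Definition grad (f : 'cV[R]_n -> R) (x : 'cV[R]_n) : 'cV[R]_n :=
  \col_i 'D_(delta_mx i 0) f x.

(* The norm of 'cV[R]_n provided by the library is the sup norm. *)
Definition enorm (x : 'cV[R]_n) : R := Num.sqrt (\sum_i x i 0 ^+ 2).

(* Extended-real valued, so that the distance to the empty set is +oo. *)
Definition dist (x : 'cV[R]_n) (X : set 'cV[R]_n) : \bar R :=
  ereal_inf [set (enorm (x - y))%:E | y in X].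

End Euclidean.

Section Algorithm.
Variables (R : realType) (m n : nat).

Definition controller_F (b : 'rV[R]_m) : 'M[R]_m :=
  \matrix_(i, j) if i.+1 == m then - b 0 j else (j == i.+1 :> nat)%:R.

Definition controller_G : 'cV[R]_m := \col_i (i.+1 == m)%:R.

(* [A *t B] is the Kronecker product; castmx only identifies 1 * n with n. *)
Definition FI (b : 'rV[R]_m) : 'M[R]_(m * n) :=
  controller_F b *t (1%:M : 'M[R]_n).

Definition GI : 'M[R]_(m * n, n) :=
  castmx (erefl (m * n)%N, mul1n n) (controller_G *t (1%:M : 'M[R]_n)).

Definition KI (c : 'rV[R]_m) : 'M[R]_(n, m * n) :=
  castmx (mul1n n, erefl (m * n)%N) (c *t (1%:M : 'M[R]_n)).

Fixpoint alg_state (b c : 'rV[R]_m) (f : nat -> 'cV[R]_n -> R)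
    (w0 : 'cV[R]_(m * n)) (k : nat) : 'cV[R]_(m * n) :=
  if k is k'.+1 then
    let w := alg_state b c f w0 k' in
    FI b *m w + GI *m grad (f k') (KI c *m w)
  else w0.

Definition alg_output (b c : 'rV[R]_m) (f : nat -> 'cV[R]_n -> R)
    (w0 : 'cV[R]_(m * n)) (k : nat) : 'cV[R]_n :=
  KI c *m alg_state b c f w0 k.

End Algorithm.

(* Main.v *)
Require Import Defs.
From HB Require Import structures.
From mathcomp Require Import all_boot all_order all_algebra.
From mathcomp Require Import all_classical all_reals all_analysis.
From mathcomp Require Import ring lra.
Import Order.TTheory GRing.Theory Num.Theory.
Local Open Scope classical_set_scope.
Local Open Scope ring_scope.

(** The proof follows the gradient [g_k = A x_k + b_k] at the iterates rather
    than the iterates themselves. Write [S] for the forward shift of sequences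
    and [p(S)] ([shiftp p]) for a polynomial in it.

    The controller is a state-space realization of [CN / BD], so that
    [BD(S) x = CN(S) g] ([controller_identity]). The internal model annihilates
    the data: as the transform of [b] has denominator [BD], the transform of
    [BD(S) b] is a polynomial, whence [BD(S) b] is eventually zero
    ([internal_model_annihilates]). Applying [BD(S)] to [g = A x + b] gives,
    for large times, the closed loop

      [BD(S) g = A CN(S) g].

    Since [A] is symmetric, this decouples along its eigenvectors into
    [(BD - a CN)(S) h = 0]. For a nonzero eigenvalue [a] this polynomial is
    asymptotically stable, hence [h] tends to zero ([normc_shiftp_decay]); for
    [a = 0] the coordinate [h] vanishes because the [b_k], and hence the [g_k],
    lie in the range of [A]. So [g] tends to zero ([decay_of_stable]).

    Finally, moving [x_k] by the image of [g_k] under the pseudo-inverse of [A]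
    cancels the gradient and thus leads to a minimizer of [f_k]
    ([residual_preimage]), so the distance is at most the norm of a fixed linear
    image of [g_k]. *)

Set Implicit Arguments.
Unset Strict Implicit.
Unset Printing Implicit Defensive.

(** * Polynomials in the shift *)

Section ShiftPolynomials.
Variables (K : comNzRingType) (V : lmodType K).
Implicit Types (p q : {poly K}) (u v : nat -> V).

(** [p(S) u], for [S] the forward shift of sequences: the linear recurrence
    with characteristic polynomial [p] is the equation [shiftp p u k = 0]. *)
Definition shiftp p u : nat -> V :=
  fun k => \sum_(i < size p) p`_i *: u (k + i)%N.

Lemma shiftp_widen N p u k : (size p <= N)%N ->
  shiftp p u k = \sum_(i < N) p`_i *: u (k + i)%N.
Proof.
move=> pN; rewrite /shiftp (big_ord_widen _ (fun i => p`_i *: u (k + i)%N) pN).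
rewrite [RHS](bigID (fun i : 'I_N => (i < size p)%N)) /=.
rewrite [X in _ + X]big1 ?addr0 //.
by move=> i; rewrite -leqNgt => pi; rewrite nth_default ?scale0r.
Qed.

Lemma shiftpD p q u k : shiftp (p + q) u k = shiftp p u k + shiftp q u k.
Proof.
have [pN qN] := (leq_maxl (size p) (size q), leq_maxr (size p) (size q)).
rewrite (shiftp_widen _ _ pN) (shiftp_widen _ _ qN).
rewrite (shiftp_widen _ _ (size_polyD p q)).
by rewrite -big_split /=; apply: eq_bigr => i _; rewrite coefD scalerDl.
Qed.

Lemma shiftpZ a p u k : shiftp (a *: p) u k = a *: shiftp p u k.
Proof.
rewrite (shiftp_widen _ _ (size_scale_leq a p)) /shiftp scaler_sumr.
by apply: eq_bigr => i _; rewrite coefZ scalerA.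
Qed.

Lemma shiftp0 u k : shiftp 0 u k = 0.
Proof. by rewrite /shiftp size_poly0 big_ord0. Qed.

Lemma shiftpC c u k : shiftp c%:P u k = c *: u k.
Proof.
by rewrite (shiftp_widen _ _ (size_polyC_leq1 c)) big_ord1 coefC addn0.
Qed.

Lemma shiftpMX p u k : shiftp (p * 'X) u k = shiftp p u k.+1.
Proof.
have sz : (size (p * 'X)%R <= (size p).+1)%N.
  by rewrite (leq_trans (size_polyMleq _ _)) // size_polyX addn2.
rewrite (shiftp_widen _ _ sz) big_ord_recl coefMX scale0r add0r.
by apply: eq_bigr => i _; rewrite coefMX /= addnS addSn.
Qed.

(** Polynomials act through a ring morphism, so polynomials in the shift compose
    as they multiply; in particular they commute. *)
Lemma shiftp_comp p q u k : shiftp (p * q) u k = shiftp p (shiftp q u) k.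
Proof.
elim/poly_ind: p k => [|p c IHp] k; first by rewrite mul0r !shiftp0.
by rewrite mulrDl mulrAC mul_polyC !shiftpD !shiftpMX shiftpZ IHp shiftpC.
Qed.

Lemma shiftp_add p u v k :
  shiftp p (fun j => u j + v j) k = shiftp p u k + shiftp p v k.
Proof. by rewrite -big_split; apply: eq_bigr => i _; rewrite scalerDr. Qed.

Lemma shiftp_sum_coef m (c : 'I_m -> K) u k :
  shiftp (\sum_(i < m) c i *: 'X^i) u k = \sum_(i < m) c i *: u (k + i)%N.
Proof.
have sz : (size (\sum_(i < m) c i *: 'X^i : {poly K})%R <= m)%N.
  apply: (leq_trans (size_sum _ _ _)); apply/bigmax_leqP => i _.
  by rewrite (leq_trans (size_scale_leq _ _)) // size_polyXn.
rewrite (shiftp_widen _ _ sz); apply: eq_bigr => i _; congr (_ *: _).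
rewrite coef_sum (bigD1 i) //= big1 ?addr0 => [|j ji].
  by rewrite coefZ coefXn eqxx mulr1.
by rewrite coefZ coefXn eq_sym (inj_eq val_inj) (negPf ji) mulr0.
Qed.

Lemma shiftpXn m u k : shiftp 'X^m u k = u (k + m)%N.
Proof.
rewrite /shiftp size_polyXn big_ord_recr /= coefXn eqxx scale1r big1 ?add0r //.
by move=> i _; rewrite coefXn ltn_eqF // scale0r.
Qed.
End ShiftPolynomials.

Lemma shiftp_mulmx (K : comNzRingType) m n (M : 'M[K]_(m, n)) q
    (u : nat -> 'cV[K]_n) k :
  shiftp q (fun j => M *m u j) k = M *m shiftp q u k.
Proof.
by rewrite /shiftp mulmx_sumr; apply: eq_bigr => j _; rewrite scalemxAr.
Qed.

(** Carries a recurrence through a coordinate map and through the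
    complexification of the scalars at the same time. *)
Lemma shiftp_semilinear (K L : comNzRingType) (f : {rmorphism K -> L})
    (V : lmodType K) (W : lmodType L) (phi : V -> W) :
    {morph phi : v w / v + w} -> (forall a v, phi (a *: v) = f a *: phi v) ->
  forall p (u : nat -> V) k,
  phi (shiftp p u k) = shiftp (map_poly f p) (fun j => phi (u j)) k.
Proof.
move=> phiD phiZ p u k; rewrite [RHS](shiftp_widen (N := size p)) ?size_poly //.
have phi0 : phi 0 = 0 by rewrite -(scale0r 0) phiZ rmorph0 scale0r.
rewrite /shiftp (big_morph phi phiD phi0).
by apply: eq_bigr => i _; rewrite phiZ coef_map.
Qed.

(** * Linear recurrences with stable characteristic polynomial *)

Section Decay.
Import ComplexField.Normc.
Variable R : realType.

(** Once [e] stays below [eps / 2 * (1 - q)], the value [eps / 2] is a barrier: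
    the part of [a] above it shrinks by the factor [q] at each step. *)
Lemma contraction_cvg0 (q : R) (a e : nat -> R) :
  0 <= q -> q < 1 -> (forall k, 0 <= a k) ->
  (forall k, a k.+1 <= q * a k + e k) ->
  e @ \oo --> 0 -> a @ \oo --> 0.
Proof.
move=> q0 q1 a0 aS /cvgrPdist_lt e0; apply/cvgrPdist_lt => eps eps0.
have q'0 : 0 < 1 - q by rewrite subr_gt0.
have [|N _ eN] := e0 (eps / 2 * (1 - q)); first by rewrite mulr_gt0 ?divr_gt0.
have bound j : a (N + j)%N <= eps / 2 + q ^+ j * a N.
  elim: j => [|j IHj]; first by rewrite addn0 expr0 mul1r lerDr divr_ge0 // ltW.
  rewrite addnS (le_trans (aS _)) //.
  have := eN (N + j)%N (leq_addr _ _).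
  rewrite /= sub0r normrN => /ltW/(le_trans (ler_norm _)) eNj.
  apply: le_trans (lerD (ler_wpM2l q0 IHj) eNj) _.
  by rewrite le_eqVlt; apply/orP; left; apply/eqP; rewrite exprS; ring.
have /cvgrPdist_lt/(_ (eps / 2)) : (fun j => q ^+ j * a N) @ \oo --> 0.
  rewrite -[0](mul0r (a N)); apply: cvgM; last exact: cvg_cst.
  by apply: cvg_expr; rewrite ger0_norm.
case=> [|M _ qM]; first by rewrite divr_gt0.
exists (N + M)%N => // k /= NMk; rewrite sub0r normrN ger0_norm //.
have Nk : (N <= k)%N := leq_trans (leq_addr _ _) NMk.
rewrite -(subnKC Nk) (le_lt_trans (bound _)) // [ltRHS]splitr ltrD2l.
have /qM : (M <= k - N)%N by rewrite leq_subRL.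
by rewrite /= sub0r normrN => /(le_lt_trans (ler_norm _)).
Qed.

Lemma normc_ge0 (z : R[i]) : 0 <= normc z.
Proof. by case: z => a b; exact: sqrtr_ge0. Qed.

Lemma normc_shift_decay (z : R[i]) (u : nat -> R[i]) : `|z| < 1 ->
  (fun k => normc (u k.+1 - z * u k)) @ \oo --> (0 : R) ->
  (fun k => normc (u k)) @ \oo --> (0 : R).
Proof.
move=> z1 v0.
apply: (contraction_cvg0 (q := normc z) _ _ _ _ v0); rewrite ?normc_ge0 //.
- by rewrite -ltcR.
- by move=> k; rewrite normc_ge0.
- move=> k; rewrite -normcM -[in leLHS](subrK (z * u k) (u k.+1)) addrC.
  exact: le_normcD.
Qed.

(** A stable polynomial splits over the complex numbers, and
    [normc_shift_decay] removes one linear factor [S - z] at a time. Allowing a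
    right-hand side that tends to zero, rather than a null one, is what makes
    this induction go through: it avoids the explicit solution of the
    recurrence and any discussion of multiple roots. *)
Lemma normc_shiftp_decay (p : {poly R[i]}) (u : nat -> R[i]^o) :
  p != 0 -> (forall z, root p z -> `|z| < 1) ->
  (fun k => normc (shiftp p u k)) @ \oo --> (0:R) ->
  (fun k => normc (u k)) @ \oo --> (0:R).
Proof.
have [rs ->] := closed_field_poly_normal p; set c := lead_coef p.
rewrite scaler_eq0 negb_or => /andP[c0 _] stable.
have {}stable z : z \in rs -> `|z| < 1.
  by move=> zrs; apply: stable; rewrite rootZ // root_prod_XsubC.
move=> cp0.
have {cp0} : (fun k => normc (shiftp (\prod_(z <- rs) ('X - z%:P)) u k))
    @ \oo --> (0:R).
  rewrite -(mulr0 (normc c)^-1).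
  have nc0 : normc c != 0 by apply: contra c0 => /eqP/eq0_normc ->.
  apply: cvg_trans (cvgM (cvg_cst (normc c)^-1) cp0).
  apply: near_eq_cvg; near=> k.
  by rewrite /= shiftpZ normcM mulKf.
elim: rs u stable => [|z rs IHrs] u stable.
  apply: cvg_trans; apply: near_eq_cvg; near=> k.
  by rewrite big_nil shiftpC scale1r.
rewrite big_cons mulrC => p0.
apply: (@normc_shift_decay z); first by rewrite stable ?mem_head.
have sE k : u k.+1 - z * u k = shiftp ('X - z%:P) u k.
  by rewrite shiftpD -['X]mul1r shiftpMX -polyCN !shiftpC scale1r scaleNr.
under eq_fun do rewrite sE.
apply: IHrs => [t trs|]; first by rewrite stable // inE trs orbT.
by under eq_fun do rewrite -shiftp_comp.
Unshelve. all: by end_near.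
Qed.
End Decay.

(** * Sequences with a rational transform *)

Section ZTransform.
Variables (R : realType) (rho : R).
Hypothesis rho_gt0 : 0 < rho.
Implicit Types (u : nat -> R^o) (U : R -> R) (p Q : {poly R}).

(** [U] need only be the sum on the real half-line beyond [rho]: that is enough
    to determine [u]. *)
Definition ztransform u U :=
  forall r, rho < r -> series (fun k => u k * r ^- k) @ \oo --> U r.

Let r_neq0 r : rho < r -> r != 0.
Proof. by move=> rr; rewrite gt_eqF // (lt_trans rho_gt0). Qed.

Lemma ztransform_shift u U : ztransform u U ->
  ztransform (fun k => u k.+1) (fun r => r * (U r - u 0%N)).
Proof.
move=> uU r rr; have r0 := r_neq0 rr.
have -> : series (fun k => u k.+1 * r ^- k) =
    (fun K => r * (series (fun k => u k * r ^- k) K.+1 - u 0%N)).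
  apply/funext => K; rewrite !seriesEord /= big_ord_recl expr0 invr1 mulr1.
  rewrite addrC addKr mulr_sumr; apply: eq_bigr => i _.
  by rewrite /= exprS invfM [RHS]mulrCA mulVKf.
apply: cvgM; first exact: cvg_cst.
apply: cvgB; last exact: cvg_cst.
by have := uU _ rr; rewrite -(cvg_shiftS (series _)).
Qed.

Lemma ztransformD u v U W : ztransform u U -> ztransform v W ->
  ztransform (fun k => u k + v k) (fun r => U r + W r).
Proof.
move=> uU vW r rr; have -> : series (fun k => (u k + v k) * r ^- k) =
   (fun K => series (fun k => u k * r ^- k) K +
             series (fun k => v k * r ^- k) K).
  apply/funext => K; rewrite !seriesEord -big_split /=.
  by apply: eq_bigr => i _; rewrite mulrDl.
by apply: cvgD; [exact: uU | exact: vW].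
Qed.

Lemma ztransformZ c u U : ztransform u U ->
  ztransform (fun k => c * u k) (fun r => c * U r).
Proof.
move=> uU r rr; have -> : series (fun k => c * u k * r ^- k) =
   (fun K => c * series (fun k => u k * r ^- k) K).
  apply/funext => K; rewrite !seriesEord mulr_sumr /=.
  by apply: eq_bigr => i _; rewrite mulrA.
by apply: cvgM; [exact: cvg_cst | exact: uU].
Qed.

(** A shift multiplies the transform by [r] and subtracts an initial value, so a
    polynomial in the shift multiplies it by that polynomial, up to a polynomial
    [Q] that collects the initial values. *)
Lemma ztransform_shiftp p u U : ztransform u U ->
  exists Q, ztransform (shiftp p u) (fun r => p.[r] * U r - Q.[r]).
Proof.
move=> uU; elim/poly_ind: p => [|p c [Q IHp]].
  exists 0 => r rr; rewrite horner0 mul0r subr0.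
  have -> : (fun k => shiftp 0 u k * r ^- k) = fun=> 0.
    by apply/funext => k; rewrite shiftp0 mul0r.
  rewrite (_ : series _ = fun=> 0) ?seriesEord; first exact: cvg_cst.
  by apply/funext => K; rewrite /= big1.
exists ((Q + (shiftp p u 0%N)%:P) * 'X) => r rr.
have -> : (p * 'X + c%:P).[r] * U r - ((Q + (shiftp p u 0%N)%:P) * 'X).[r] =
    r * (p.[r] * U r - Q.[r] - shiftp p u 0%N) + c * U r.
  by rewrite !hornerE; ring.
have -> : shiftp (p * 'X + c%:P) u = (fun k => shiftp p u k.+1 + c * u k).
  by apply/funext => k; rewrite shiftpD shiftpMX shiftpC.
exact: (ztransformD (ztransform_shift IHp) (ztransformZ (c := c) uU) rr).
Qed.

(** The sum of the series tends to its leading term as [r] grows: the terms are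
    bounded at [r0], so at [r0 / q] the tail is dominated by a geometric series
    of ratio [q], and [q] can be taken as small as needed. *)
Lemma ztransform0_head u : ztransform u (fun=> 0) -> u 0%N = 0.
Proof.
move=> u0; apply/eqP; apply/negPn/negP => un0.
have a0 : 0 < `|u 0%N| by rewrite normr_gt0.
pose r0 := rho + 1; have rr0 : rho < r0 by rewrite ltrDl.
have r0_gt0 : 0 < r0 := lt_trans rho_gt0 rr0.
have [M M0 uM] : exists2 M, 0 < M & forall k, `|u k * r0 ^- k| <= M.
  have /cvg_series_cvg_0 t0 : cvgn (series (fun k => u k * r0 ^- k)).
    by apply/cvg_ex; exists 0; exact: u0.
  have /cvg_seq_bounded/pinfty_ex_gt0[M M0 MP] : cvgn (fun k => u k * r0 ^- k).
    by apply/cvg_ex; exists 0.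
  by exists M => // k; exact: MP.
pose q := Num.min 2^-1 (`|u 0%N| / (4 * M)).
have q0 : 0 < q by rewrite lt_min invr_gt0 ltr0n divr_gt0 // mulr_gt0.
have q2 : q <= 2^-1 by rewrite ge_min lexx.
have qM : q * M <= `|u 0%N| / 4.
  have : q <= `|u 0%N| / (4 * M) by rewrite ge_min lexx orbT.
  by rewrite ler_pdivlMr ?mulr_gt0 // => ?; lra.
(* The bounds on [q] make [q * M / (1 - q)] at most half of the leading term. *)
have rr : rho < r0 / q.
  by rewrite (lt_le_trans rr0) // ler_pdivlMr // ler_piMr //; lra.
have tail K :
    `|series (fun k => u k * (r0 / q) ^- k) K.+1 - u 0%N| <= `|u 0%N| / 2.
  rewrite seriesEord /= big_ord_recl expr0 invr1 mulr1 addrC addKr.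
  apply: le_trans (ler_norm_sum _ _ _) _.
  apply: (@le_trans _ _ (series (geometric (q * M) q) K)).
    rewrite seriesEord; apply: ler_sum => i _ /=.
    rewrite expr_div_n invf_div mulrCA normrM.
    rewrite (ger0_norm (exprn_ge0 _ (ltW q0))).
    by rewrite -mulrA mulrCA -exprS mulrC ler_wpM2r // exprn_ge0 // ltW.
  apply: le_trans (geometric_le_lim _ _ _ _) _ => //.
  - by rewrite mulr_ge0 ?ltW.
  - by rewrite ger0_norm ?ltW //; lra.
  - rewrite ler_pdivrMr; last lra.
    apply: (le_trans qM); have := a0; nra.
have /cvgrPdist_lt/(_ (`|u 0%N| / 2)) := u0 _ rr.
case=> [|K _ /(_ K.+1 (leqnSn K))]; first by rewrite divr_gt0.
rewrite /= sub0r normrN => h.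
have := tail K; set S := series _ _ in h *.
have := ler_normB S (S - u 0%N); rewrite subKr; lra.
Qed.

Lemma ztransform0 u : ztransform u (fun=> 0) -> forall k, u k = 0.
Proof.
move=> + k; elim: k u => [|k IHk] u u0; first exact: ztransform0_head.
apply: (IHk (fun k => u k.+1)) => r rr; have := ztransform_shift u0 rr.
by rewrite (ztransform0_head u0) subrr mulr0.
Qed.

(** A positive power of [r] in a transform would have to come from a negative
    index. Delaying the sequence by one step divides [Q * 'X + c] by [r], and
    removing [c] from the delayed sequence leaves the transform [Q]: the degree
    drops until the transform vanishes. *)
Lemma ztransform_horner u Q : ztransform u (fun r => Q.[r]) ->
  \forall k \near \oo, u k = 0.
Proof.
elim/poly_ind: Q u => [|Q c IHQ] u uQ.
  by near=> k; apply: ztransform0 => r rr; have := uQ _ rr; rewrite horner0.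
pose v := fun k =>
  if k is j.+1 then u j - (if j == 0%N then c else 0) else 0 : R^o.
have [|N _ vN] := IHQ v; last first.
  exists N.+1 => // k /= Nk; have := vN k.+1 (leqW (ltnW Nk)).
  by rewrite /= gtn_eqF ?subr0 // (leq_trans _ Nk).
move=> r rr; have r0 := r_neq0 rr.
(* Two terms are skipped: the null head of [v], and the one that carries [c]. *)
rewrite -(cvg_shiftS (series _)) -(cvg_shiftS (fun _ => _)).
have -> : Q.[r] = r^-1 * ((Q * 'X + c%:P).[r] - c).
  by rewrite !hornerE addrK [_ * r]mulrC mulKf.
have -> : [sequence [sequence series (fun k => v k * r ^- k) n.+1]_n n.+1]_n =
    (fun K => r^-1 * (series (fun k => u k * r ^- k) K.+1 - c)).
  apply/funext => K; rewrite !seriesEord /= big_ord_recl mul0r add0r.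
  rewrite !big_ord_recl /= expr0 expr1 invr1 mulr1.
  rewrite addrAC mulrDr [in LHS]mulrC mulr_sumr; congr (_ + _).
  by apply: eq_bigr => i _; rewrite subr0 [in LHS]exprS invfM mulrCA.
apply: cvgM; first exact: cvg_cst.
apply: cvgB; last exact: cvg_cst.
by have := uQ _ rr; rewrite -(cvg_shiftS (series _)).
Unshelve. all: by end_near.
Qed.

End ZTransform.

Section InternalModel.
Variable R : realType.
Local Notation toC := (real_complex R).

Lemma cvg_real_complex (s : nat -> R) (l : R) :
  (fun K => toC (s K) : R[i]^o) @ \oo --> (toC l : R[i]^o) -> s @ \oo --> l.
Proof.
move=> /cvgrPdist_lt sl; apply/cvgrPdist_lt => e e0.
have /sl : 0 < toC e by rewrite ltcR.
apply: filterS => k; rewrite -rmorphB /= normc_def /= expr0n addr0 sqrtr_sqr.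
by rewrite ltcR.
Qed.

Lemma rational_ztransform_real n (b : nat -> 'cV[R]_n) (N : 'cV[{poly R}]_n)
    D i :
  has_rational_ztransform b N D ->
  exists2 rho, 1 <= rho &
    ztransform rho (fun k => b k i 0) (fun r => (N i 0).[r] / D.[r]).
Proof.
case=> rho bN; exists (Num.max rho 1); first by rewrite le_max lexx orbT.
move=> r; rewrite gt_max => /andP[rho_r r1].
have := bN (toC r); rewrite ger0_norm ?ler0c ?(le_trans ler01 (ltW r1)) // ltcR.
move=> /(_ rho_r i) h; apply: cvg_real_complex.
move: h; rewrite !horner_map -fmorph_div /=; apply: cvg_trans.
apply: near_eq_cvg; near=> K; rewrite !seriesEord /= rmorph_sum.
by apply: eq_bigr => k _; rewrite rmorphM /= fmorphV rmorphXn.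
Unshelve. all: by end_near.
Qed.

Lemma shiftp_mxE n p (b : nat -> 'cV[R]_n) k i :
  (shiftp p b k) i 0 = shiftp p (fun j => b j i 0 : R^o) k.
Proof. by rewrite /shiftp summxE; apply: eq_bigr => j _; rewrite mxE. Qed.

(** The transform of [D(S) b] is that of [b] times [D], up to a polynomial; as
    [D] is the denominator, it is a polynomial. Stability keeps the
    zeros of [D] below [rho], so that the denominator can be cleared at every
    real beyond. *)
Lemma internal_model_annihilates n (b : nat -> 'cV[R]_n)
    (N : 'cV[{poly R}]_n) D :
  marginally_or_asymptotically_stable D -> has_rational_ztransform b N D ->
  \forall k \near \oo, shiftp D b k = 0.
Proof.
move=> stD bN.
suff : forall i, \forall k \near \oo, (shiftp D b k) i 0 = 0.
  move=> /filter_forall; apply: filterS => k bk.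
  by apply/matrixP => i j; rewrite ord1 bk mxE.
move=> i; have [rho rho1 bz] := rational_ztransform_real i bN.
have [Q DQ] := ztransform_shiftp (lt_le_trans ltr01 rho1) D bz.
have : ztransform rho (shiftp D (fun k => b k i 0 : R^o))
    (fun r => (N i 0 - Q).[r]).
  move=> r rr; have := DQ r rr.
  have D0 : D.[r] != 0.
    apply: contraTneq (le_lt_trans rho1 rr) => Dr.
    have /stD : root (map_poly toC D) (toC r).
      by rewrite /root horner_map Dr rmorph0.
    rewrite -leNgt normc_def /= expr0n addr0 sqrtr_sqr lecR.
    exact: le_trans (ler_norm _).
  by rewrite hornerD hornerN mulrC divfK.
move/(ztransform_horner (lt_le_trans ltr01 rho1)); apply: filterS => k.
by rewrite shiftp_mxE.
Qed.

End InternalModel.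

(** * Decay along the eigenvectors of a symmetric matrix *)

Lemma cvg0_sum (R : realType) (I : finType) (f : I -> nat -> R) :
  (forall i, f i @ \oo --> 0) -> (fun k => \sum_i f i k) @ \oo --> 0.
Proof.
move=> f0.
have := @cvg_big R^o I +%R 0 xpredT (@add_continuous R^o) nat \oo
  (index_enum I) f (fun=> 0) _ (fun i _ => f0 i).
by rewrite [X in _ --> X]big1 //; exact.
Qed.

Section ModalDecay.
Import ComplexField.Normc.
Variable R : realType.
Local Notation toC := (real_complex R).

Lemma asymptotically_stable_neq0 (p : {poly R}) :
  asymptotically_stable p -> p != 0.
Proof.
move=> stab; apply/eqP => p0; have := stab 1.
by rewrite p0 rmorph0 root0 normr1 ltxx => /(_ isT).
Qed.

(** A real symmetric matrix is hermitian, hence unitarily diagonalizable over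
    the complex numbers with real diagonal; being roots of the characteristic
    polynomial, the diagonal entries are eigenvalues of the real matrix. The
    diagonalization is stated on coordinates, as this is how it is used. *)
Lemma symmetric_complex_diag n (A : 'M[R]_n) : A^T = A ->
  exists2 P : 'M[R[i]]_n, P \in unitmx &
  exists2 d : 'I_n -> R, (forall l, eigenvalue A (d l)) &
    forall l (v : 'cV[R]_n),
    (P *m map_mx toC (A *m v)) l 0 = toC (d l) * (P *m map_mx toC v) l 0.
Proof.
move=> symA; pose B := map_mx toC A.
have hermB : B \is hermsymmx.
  apply/is_hermitianmxP; rewrite expr0 scale1r; apply/matrixP => i j.
  rewrite !mxE -[in LHS]symA mxE; symmetry; apply: conj_Creal.
  by apply/complex_realP; exists (A j i).
have /orthomx_spectralP := hermitian_normalmx hermB.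
set P := spectralmx B; set s := spectral_diag B => BE.
have Pu : P \in unitmx := spectral_unit B.
have PB : P *m B = diag_mx s *m P.
  by rewrite {1}BE !mulmxA mulmxV // mul1mx.
have /mxOverP sreal := hermitian_spectral_diag_real hermB.
have sE l : s 0 l = toC (complex.Re (s 0 l)).
  by rewrite RRe_real.
exists P => //; exists (fun l => complex.Re (s 0 l)) => [l|l v].
  rewrite eigenvalue_root_char -(fmorph_root toC) map_char_poly.
  rewrite -eigenvalue_root_char.
  apply/eigenvalueP; exists (row l P).
    by rewrite -row_mul PB; apply/rowP => j; rewrite mxE mul_diag_mx !mxE {1}sE.
  apply/eqP => Pl0.
  have /matrixP/(_ 0 l)/eqP : (delta_mx 0 l : 'rV[R[i]]_n) = 0.
    by rewrite -(mulmxK Pu (delta_mx 0 l)) -rowE Pl0 mul0mx.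
  by rewrite !mxE !eqxx oner_eq0.
by rewrite map_mxM mulmxA PB -mulmxA mul_diag_mx [in LHS]mxE {1}sE.
Qed.

(** In an eigenbasis of [A] the vector recurrence [p(S) g = A q(S) g] becomes
    the scalar recurrences [(p - a q)(S) h = 0], one for each eigenvalue [a].
    The
    null eigenvalues, about which stability says nothing, are harmless: the
    corresponding coordinates of a vector in the range of [A] are zero. *)
Lemma decay_of_stable n (A : 'M[R]_n) (g : nat -> 'cV[R]_n) p q :
  A^T = A -> (forall k, exists v, g k = A *m v) ->
  (forall a, eigenvalue A a -> a != 0 ->
     asymptotically_stable (p - a *: q)) ->
  (\forall k \near \oo, shiftp p g k = shiftp q (fun j => A *m g j) k) ->
  forall i, (fun k => g k i 0) @ \oo --> (0 : R).
Proof.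
move=> symA gA stab gE i.
have [P Pu [d dA PA]] := symmetric_complex_diag symA.
pose phi l (v : 'cV[R]_n) : R[i]^o := (P *m map_mx toC v) l 0.
have phiD l : {morph phi l : v w / v + w}.
  by move=> v w; rewrite /phi map_mxD mulmxDr mxE.
have phiZ l a v : phi l (a *: v) = toC a *: phi l v.
  by rewrite /phi map_mxZ -scalemxAr mxE.
have h0 l : (fun k => normc (phi l (g k))) @ \oo --> (0 : R).
  have [d0|d0] := eqVneq (d l) 0.
    have -> : (fun k => normc (phi l (g k))) = fun=> 0; last exact: cvg_cst.
    apply/funext => k; have [v ->] := gA k.
    by rewrite /phi PA d0 mul0r normc0.
  have pq := stab _ (dA l) d0.
  apply: (normc_shiftp_decay _ pq).
    by rewrite map_poly_eq0 asymptotically_stable_neq0.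
  apply: cvg_near_cst.
  apply: filterS gE => k gk.
  rewrite -(shiftp_semilinear (phiD l) (phiZ l)) shiftpD -scaleNr shiftpZ gk.
  by rewrite shiftp_mulmx phiD phiZ /phi PA rmorphN scaleNr subrr normc0.
pose G (k : nat) : R := \sum_l normc (invmx P i l) * normc (phi l (g k)).
have G0 : G @ \oo --> (0 : R).
  apply: cvg0_sum => l; rewrite -(mulr0 (normc (invmx P i l))).
  by apply: cvgM; [exact: cvg_cst | exact: h0].
apply: norm_cvg0; apply: (squeeze_cvgr _ (cvg_cst 0) G0); near=> k.
rewrite normr_ge0 /=.
have -> : `|g k i 0| = normc (toC (g k i 0)).
  by rewrite /= expr0n addr0 sqrtr_sqr.
have -> : toC (g k i 0) = \sum_l invmx P i l * phi l (g k).
  transitivity (map_mx toC (g k) i 0); first by rewrite mxE.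
  by rewrite -[in LHS](mulKmx Pu (map_mx toC (g k))) mxE.
apply: (big_ind2 (fun x y => normc x <= y)); first by rewrite normc0.
  by move=> x y x' y' xy xy'; apply: le_trans (le_normcD _ _) (lerD xy xy').
by move=> l _; rewrite normcM.
Unshelve. all: by end_near.
Qed.

End ModalDecay.

(** * Quadratic costs and their minimizers *)

Section Quadratic.
Variables (R : realType) (n : nat) (A : 'M[R]_n).
Hypothesis symA : A^T = A.

Lemma quad_costD (b x z : 'cV[R]_n) :
  quad_cost A b (x + z) =
  quad_cost A b x + (z^T *m (A *m x + b)) 0 0 + 2^-1 * (z^T *m A *m z) 0 0.
Proof.
have tr1 (B : 'M[R]_1) : B^T 0 0 = B 0 0 by rewrite mxE.
have xz : (x^T *m A *m z) 0 0 = (z^T *m (A *m x)) 0 0.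
  by rewrite -tr1 !trmx_mul trmxK symA mulmxA.
have addE (B C : 'M[R]_1) : (B + C) 0 0 = B 0 0 + C 0 0 by rewrite mxE.
rewrite /quad_cost [(x + z)^T]linearD /= !(mulmxDl, mulmxDr) !addE xz -!mulmxA.
by field.
Qed.

Lemma quad_costZ (b x z : 'cV[R]_n) (h : R) :
  quad_cost A b (h *: z + x) - quad_cost A b x =
  h * ((z^T *m (A *m x + b)) 0 0 + h * (2^-1 * (z^T *m A *m z) 0 0)).
Proof.
have scaleE (B : 'M[R]_1) : (h *: B) 0 0 = h * B 0 0 by rewrite mxE.
rewrite addrC (addrC (h *: z)) quad_costD [(h *: z)^T]linearZ /=.
by rewrite -!scalemxAl -scalemxAr !scaleE; ring.
Qed.

Lemma grad_quad_cost (b x : 'cV[R]_n) : grad (quad_cost A b) x = A *m x + b.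
Proof.
apply/matrixP => i j; rewrite ord1 mxE /derive.
set z : 'cV[R]_n := delta_mx i 0; set c := 2^-1 * (z^T *m A *m z) 0 0.
have -> : (A *m x + b) i 0 = (z^T *m (A *m x + b)) 0 0.
  by rewrite trmx_delta -rowE [RHS]mxE.
set d := (z^T *m _) 0 0.
have lim_d : (fun h : R => d + h * c) @ 0^' --> d.
  rewrite -[X in _ --> X]addr0; apply: cvgD; first exact: cvg_cst.
  rewrite -[X in _ --> X](mul0r c); apply: cvgM; last exact: cvg_cst.
  exact: nbhs_dnbhs.
apply: cvg_lim => //; apply: cvg_trans lim_d; apply: near_eq_cvg; near=> h.
have h0 : h != 0 by near: h; exact: nbhs_dnbhs_neq.
by rewrite /= quad_costZ -[_ *: _]/(_ * _) mulKf.
Unshelve. all: by end_near.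
Qed.

Lemma stationary_minimizer (b y : 'cV[R]_n) : pos_semidef A ->
  A *m y + b = 0 -> minimizers (quad_cost A b) y.
Proof.
move=> psdA Ay x; rewrite -(subrK y x) addrC quad_costD Ay mulmx0 mxE addr0.
by rewrite lerDl mulr_ge0 // psdA.
Qed.

(** The pseudo-inverse provides a minimizer at a displacement from [x] that is a
    fixed linear function of the gradient at [x]. *)
Lemma residual_preimage (b x : 'cV[R]_n) :
  (exists v, A *m x + b = A *m v) ->
  A *m (x - (pinvmx A)^T *m (A *m x + b)) + b = 0.
Proof.
case=> v E; set g := A *m x + b in E *.
have Ag : A *m ((pinvmx A)^T *m g) = g.
  apply: trmx_inj; rewrite trmx_mul [(_ *m g)^T]trmx_mul trmxK symA mulmxKpV //.
  by rewrite E trmx_mul symA submxMl.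
by rewrite mulmxBr Ag /g opprD addrA subrr add0r addNr.
Qed.
End Quadratic.

Section Distance.
Variables (R : realType) (n : nat).

Lemma dist_ge0 (x : 'cV[R]_n) X : (0 <= dist x X)%E.
Proof.
by apply/ereal_infP => _ [y _ <-]; rewrite lee_fin sqrtr_ge0.
Qed.

Lemma dist_le (x y : 'cV[R]_n) (X : set 'cV[R]_n) :
  X y -> (dist x X <= (enorm (x - y))%:E)%E.
Proof. by move=> Xy; apply: ereal_inf_lbound; exists y. Qed.

Lemma enorm_cvg0 (e : nat -> 'cV[R]_n) :
  (forall i, (fun k => e k i 0) @ \oo --> (0:R)) ->
  (fun k => enorm (e k)) @ \oo --> (0:R).
Proof.
move=> e0; rewrite -[X in _ --> X](@sqrtr0 R).
have sum0 : (fun k => \sum_i e k i 0 ^+ 2) @ \oo --> (0 : R).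
  apply: cvg0_sum => i; rewrite -[X in _ --> X](mulr0 (0 : R)).
  by under eq_fun do rewrite expr2; apply: cvgM; exact: e0.
exact: cvg_comp sum0 (@sqrt_continuous R 0).
Qed.

Lemma mulmx_cvg0 m (B : 'M[R]_(m, n)) (e : nat -> 'cV[R]_n) :
  (forall i, (fun k => e k i 0) @ \oo --> (0:R)) ->
  forall i, (fun k => (B *m e k) i 0) @ \oo --> (0:R).
Proof.
move=> e0 i; under eq_fun do rewrite mxE.
apply: cvg0_sum => j; rewrite -(mulr0 (B i j)).
by apply: cvgM; [exact: cvg_cst | exact: e0].
Qed.

Lemma limn_esup_dist0 (x y : nat -> 'cV[R]_n) (X : nat -> set 'cV[R]_n) :
  (forall k, X k (y k)) ->
  (fun k => enorm (x k - y k)) @ \oo --> (0:R) ->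
  limn_esup (fun k => dist (x k) (X k)) = 0%E.
Proof.
move=> Xy xy0.
have dist0 : (fun k => dist (x k) (X k)) @ \oo --> (0%:E : \bar R).
  apply: (@squeeze_cvge _ _ _ _ (fun=> 0%:E) _
    (fun k => (enorm (x k - y k))%:E)).
  - by near=> k; rewrite dist_ge0 dist_le.
  - exact: cvg_cst.
  - by apply: cvg_EFin => //; near=> k.
by rewrite (cvg_limn_einf_sup dist0).
Unshelve. all: by end_near.
Qed.
End Distance.

(** * The controller *)

Section Loop.
Variables (R : realType) (m n : nat).

(** The Kronecker products with the identity act on [m] blocks of size [n]. *)
Definition block (i : 'I_m) (w : 'cV[R]_(m * n)) : 'cV[R]_n :=
  \col_j w (mxtens_index (i, j)) 0.

Lemma sum_mxtens (F : 'I_(m * n) -> R) :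
  \sum_k F k = \sum_i \sum_j F (mxtens_index (i, j)).
Proof.
rewrite pair_big /= (reindex (@mxtens_index m n)) /=.
  by apply: eq_bigr => -[].
by exists (@mxtens_unindex m n) => k _;
  rewrite (mxtens_indexK, mxtens_unindexK).
Qed.

Let mul1n_index (j : 'I_n) :
  cast_ord (esym (mul1n n)) j = mxtens_index (0, j) :> 'I_(1 * n).
Proof. by apply: val_inj. Qed.

Lemma block_FI (b : 'rV[R]_m) i w :
  block i (FI n b *m w) = \sum_i' controller_F b i i' *: block i' w.
Proof.
apply/matrixP => j z; rewrite ord1 !mxE sum_mxtens summxE.
apply: eq_bigr => i' _.
rewrite (bigD1 j) //= big1 => [|j' j'j]; rewrite /FI tensmxE [1%:M _ _]mxE.
  by rewrite eqxx mulr1 addr0 !mxE.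
by rewrite eq_sym (negPf j'j) mulr0 mul0r.
Qed.

Lemma block_GI i (v : 'cV[R]_n) :
  block i (GI R m n *m v) = (i.+1 == m)%:R *: v.
Proof.
apply/matrixP => j z; rewrite ord1 !mxE (bigD1 j) //= big1 => [|j' j'j];
  rewrite /GI castmxE /= cast_ord_id mul1n_index tensmxE !mxE.
  by rewrite eqxx mulr1 addr0.
by rewrite [j == j']eq_sym (negPf j'j) mulr0 mul0r.
Qed.

Lemma KI_block (c : 'rV[R]_m) w :
  KI n c *m w = \sum_i c 0 i *: block i w.
Proof.
apply/matrixP => j z; rewrite ord1 !mxE sum_mxtens summxE.
apply: eq_bigr => i _.
rewrite (bigD1 j) //= big1 => [|j' j'j];
  rewrite /KI castmxE /= cast_ord_id mul1n_index tensmxE !mxE.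
  by rewrite eqxx mulr1 addr0.
by rewrite [j == j']eq_sym (negPf j'j) mulr0 mul0r.
Qed.

Lemma blockD i (v w : 'cV[R]_(m * n)) : block i (v + w) = block i v + block i w.
Proof. by apply/matrixP => j z; rewrite !mxE. Qed.

Section State.
Variables (b c : 'rV[R]_m) (f : nat -> 'cV[R]_n -> R) (w0 : 'cV[R]_(m * n)).
Let w := alg_state b c f w0.
Let g k := grad (f k) (alg_output b c f w0 k).

Lemma block_stateS (i : 'I_m) k :
  block i (w k.+1) =
  \sum_i' controller_F b i i' *: block i' (w k) + (i.+1 == m)%:R *: g k.
Proof. by rewrite /w /= blockD block_FI block_GI. Qed.

Lemma block_state_next (i : 'I_m) (iS : (i.+1 < m)%N) k :
  block i (w k.+1) = block (Ordinal iS) (w k).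
Proof.
rewrite block_stateS ltn_eqF // scale0r addr0 (bigD1 (Ordinal iS)) //= big1.
  by rewrite mxE ltn_eqF //= eqxx scale1r addr0.
move=> j jiS; rewrite mxE ltn_eqF //.
rewrite (_ : (j == i.+1 :> nat) = false) ?scale0r //.
by apply: contraNF jiS => /eqP ji; apply/eqP/val_inj.
Qed.

Lemma block_state_last (i : 'I_m) k : i.+1 = m ->
  block i (w k.+1) = g k - \sum_i' b 0 i' *: block i' (w k).
Proof.
move=> im; rewrite block_stateS im eqxx scale1r addrC; congr (_ + _).
by rewrite -sumrN; apply: eq_bigr => j _; rewrite mxE im eqxx scaleNr.
Qed.
End State.

End Loop.

(** The transfer function [x = CN(S) / BD(S) g] of the state-space realization.
    The companion matrix makes the blocks of the state successive values of its
    first block [y], which satisfies [BD(S) y = g] and [x = CN(S) y]; the claim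
    follows since the two operators commute. *)
Lemma controller_identity (R : realType) (m n : nat) (b c : 'rV[R]_m)
    (f : nat -> 'cV[R]_n -> R) w0 k :
  let x := alg_output b c f w0 in
  shiftp ('X^m + \sum_(i < m) b 0 i *: 'X^i) x k =
  shiftp (\sum_(i < m) c 0 i *: 'X^i) (fun j => grad (f j) (x j)) k.
Proof.
case: m b c w0 => [|m] b c w0 x.
  (* Without state there is no block [y], but the output is zero. *)
  rewrite !big_ord0 addr0 shiftpXn shiftp0 addn0 /x /alg_output KI_block.
  by rewrite big_ord0.
pose y k := block ord0 (alg_state b c f w0 k).
have yE i j : block i (alg_state b c f w0 j) = y (j + i)%N.
  case: i => i im; elim: i j im => [|i IHi] j im.
    by rewrite addn0 /y; congr block; apply: val_inj.
  by rewrite -(block_state_next _ _ _ _ (i := Ordinal (ltnW im)) im) IHi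
    addSnnS.
have xE : x = shiftp (\sum_(i < m.+1) c 0 i *: 'X^i) y.
  apply/funext => j; rewrite shiftp_sum_coef /x /alg_output KI_block.
  by apply: eq_bigr => i _; rewrite yE.
have gE : (fun j => grad (f j) (x j)) =
    shiftp ('X^(m.+1) + \sum_(i < m.+1) b 0 i *: 'X^i) y.
  apply/funext => j; rewrite shiftpD shiftpXn shiftp_sum_coef addnS -addSn.
  rewrite -(yE ord_max) block_state_last //.
  under [X in _ - X]eq_bigr do rewrite yE.
  by rewrite subrK.
by rewrite gE {1}xE -!shiftp_comp mulrC.
Qed.

(** * Convergence of the closed loop *)

Theorem proposition2 (R : realType) (m n r : nat) (lo hi : R)
    (A : 'M[R]_n) (b : nat -> 'cV[R]_n)
    (bD cN : 'rV[R]_m) (BN : 'cV[{poly R}]_n) (BD CN CD : {poly R})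
    (w0 : 'cV[R]_(m * n)) :
  0 < lo -> lo <= hi ->
  A^T = A -> pos_semidef A ->
  \rank A = r -> (r < n)%N ->
  (forall a : R, eigenvalue A a -> a != 0 -> lo <= a <= hi) ->
  (forall k : nat, exists v : 'cV[R]_n, b k = A *m v) ->
  BD = 'X^m + \sum_(i < m) bD 0 i *: 'X^i ->
  marginally_or_asymptotically_stable BD ->
  has_rational_ztransform b BN BD ->
  CN = \sum_(i < m) cN 0 i *: 'X^i ->
  CD = BD ->
  (forall lambda : R, lo <= lambda <= hi ->
     asymptotically_stable (BD - lambda *: CN)) ->
  let f := fun k : nat => quad_cost A (b k) in
  let x := alg_output bD cN f w0 in
  limn_esup (fun k : nat => dist (x k) (minimizers (f k))) = 0%E.
Proof.
move=> _ _ symA psdA _ _ Alohi bA BDE BDst bz CNE CDE stab f x.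
pose g k := A *m x k + b k.
have gE : (fun k => grad (f k) (x k)) = g.
  by apply/funext => k; rewrite /f grad_quad_cost.
have g_range k : exists v, g k = A *m v.
  by have [v bv] := bA k; exists (x k + v); rewrite mulmxDr -bv.
have loop : \forall k \near \oo,
    shiftp BD g k = shiftp CN (fun j => A *m g j) k.
  apply: filterS (internal_model_annihilates BDst bz) => k bk.
  rewrite shiftp_add bk addr0 !(shiftp_mulmx A); congr (_ *m _).
  by rewrite BDE CNE -gE; exact: controller_identity.
have g0 i : (fun k => g k i 0) @ \oo --> (0 : R).
  apply: (decay_of_stable symA g_range _ loop) => a Aa a0.
  by apply: stab; exact: Alohi.
pose y k := x k - (pinvmx A)^T *m g k.
apply: (limn_esup_dist0 (y := y)) => [k|].
  apply: stationary_minimizer => //.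
  exact: (residual_preimage symA (g_range k)).
apply: enorm_cvg0 => i; under eq_fun do rewrite /y subKr.
exact: mulmx_cvg0.
Qed.
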